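(* Let $T\ge 0$ be an integer, let $(\Omega,\mathcal F,\mathbb P_\pi)$ be the probability space of rollouts $\omega=(o_0,\dots,o_T)$, let $\mathcal F_t=\sigma(o_0,\dots,o_t)$ for $0\le t\le T$, and let $S:\Omega\to\{0,1\}$ be the terminal success label, which is $\mathcal F_T$-measurable. Define the success-probability reward by $r_T:=S$ and, for $0\le t<T$, $r_t:=\mathbb E_\pi[S\mid\mathcal F_t]=\mathbb P_\pi(S=1\mid\mathcal F_t)$. Then, for every $0\le t\le T$, $$r_t=\mathbb E_\pi[r_T\mid\mathcal F_t]\quad\text{almost surely},$$ and, for every $0\le t<T$, $$\mathbb E_\pi[r_{t+1}\mid\mathcal F_t]=r_t\quad\text{almost surely}.$$
   Context: Let $\mathcal O$ be a measurable space (the observation space) and $T$ a fixed rollout length. $\Omega$ is the space of rollouts $\omega=(o_0,o_1,\dots,o_T)$ with each $o_t\in\mathcal O$, $\mathcal F$ is its $\sigma$-algebra of events, and $\mathbb P_\pi$ is a probability measure on $(\Omega,\mathcal F)$ (the distribution of rollouts induced by a given policy $\pi$ and the environment); $\mathbb E_\pi$ is expectation under $\mathbb P_\pi$. The trajectory prefix is $H_t=(o_0,\dots,o_t)$ and $\mathcal F_t:=\sigma(H_t)$, so $\mathcal F_t\subseteq\mathcal F_{t+1}\subseteq\mathcal F$. Each rollout carries a binary terminal success label $S\in\{0,1\}$ determined by the complete rollout, i.e. $S$ is $\mathcal F_T$-measurable. Equalities between conditional expectations are understood $\mathbb P_\pi$-almost surely. *)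

(* Defs.v *)
From HB Require Import structures.
From mathcomp Require Import all_boot all_order all_algebra.
From mathcomp Require Import all_classical all_reals all_analysis.

Set Implicit Arguments.
Unset Strict Implicit.
Unset Printing Implicit Defensive.

Import Order.TTheory GRing.Theory Num.Theory.

Local Open Scope classical_set_scope.
Local Open Scope ring_scope.

(* Y is a version of E[X | G].  G is meant to be a sub-sigma-algebra of the
   measurable sets of Omega; g_sigma_algebraType G is Omega equipped with
   <<s G>> (that is, G), so the first clause is G-measurability of Y. *)
Definition is_condexp d (Omega : measurableType d) (R : realType)
    (P : probability Omega R) (G : set (set Omega)) (X Y : Omega -> R) : Prop :=
  [/\ measurable_fun [set: g_sigma_algebraType G] (Y : g_sigma_algebraType G -> R),
      P.-integrable [set: Omega] (EFin \o Y) &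
      forall A : set Omega, G A ->
        (\int[P]_(w in A) (Y w)%:E = \int[P]_(w in A) (X w)%:E)%E].

(* A chosen version of E[X | G]; the value 0 is used only when there is none,
   which does not happen for integrable X and a sub-sigma-algebra G. *)
Definition condexp d (Omega : measurableType d) (R : realType)
    (P : probability Omega R) (G : set (set Omega)) (X : Omega -> R) :
    Omega -> R :=
  xget (cst 0) [set Y | is_condexp P G X Y].

Definition condprob d (Omega : measurableType d) (R : realType)
    (P : probability Omega R) (G : set (set Omega)) (A : set Omega) :
    Omega -> R :=
  condexp P G (\1_A).

(* sigma(o_0, ..., o_t) on the space of rollouts (o_0, ..., o_T). *)
Definition obs_filtration d (O : measurableType d) (T t : nat) :
    set (set (T.+1.-tuple O)) :=
  <<s \bigcup_(s in [set s : 'I_T.+1 | (s <= t)%N])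
        preimage_set_system [set: T.+1.-tuple O]
          (fun w => tnth w s) measurable >>.
Arguments obs_filtration {d} O T t.

(* The label true stands for success, S = 1. *)
Definition label_val (R : realType) (Omega : Type) (S : Omega -> bool) :
    Omega -> R :=
  fun w => (S w)%:R.

(* Only the times t <= T are meaningful.  Rollouts carry an arbitrary
   sigma-algebra F of events, which may be larger than sigma(o_0, ..., o_T). *)
Definition reward d (O : measurableType d) (R : realType) (T : nat)
    (F : set (set (T.+1.-tuple O))) (P : probability (g_sigma_algebraType F) R)
    (S : T.+1.-tuple O -> bool) (t : nat) : T.+1.-tuple O -> R :=
  if t == T then label_val R S
  else condexp P (obs_filtration O T t) (label_val R S).

Lemma reward_condprob d (O : measurableType d) (R : realType) (T : nat)
    (F : set (set (T.+1.-tuple O))) (P : probability (g_sigma_algebraType F) R)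
    (S : T.+1.-tuple O -> bool) (t : nat) : (t < T)%N ->
  reward P S t = condprob P (obs_filtration O T t) [set w | S w = true].
Proof.
rewrite /condprob.
have -> : \1_[set w | S w = true] = label_val R S.
  apply/funext => w; rewrite /label_val indicE.
  by congr (nat_of_bool _)%:R; apply/idP/idP; rewrite inE.
by move=> tT; rewrite /reward ltn_eqF.
Qed.

(* Main.v *)
(* Conditional expectations exist by Radon-Nikodym: restrict P to G and
   differentiate the charge A |-> E[X; A] with respect to the restriction.  They
   are unique up to P-null sets because two versions have the same integral on
   every event of G.  For t <= T the reward r_t is a version of E[S | F_t] (at
   t = T because S is F_T-measurable), so the first claim is uniqueness and the
   second is the tower property: F_t is contained in F_(t+1), hence r_t is also a
   version of E[r_(t+1) | F_t]. *)
Require Import Defs.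
From HB Require Import structures.
From mathcomp Require Import all_boot all_order all_algebra.
From mathcomp Require Import all_classical all_reals all_analysis.
From mathcomp Require Import measurable_realfun.

Import Order.TTheory GRing.Theory Num.Theory.

Local Open Scope classical_set_scope.
Local Open Scope ring_scope.

Lemma measurable_fun_coarser {d d' : measure_display} {T : measurableType d}
    {U : measurableType d'} {G : set (set T)} {f : T -> U} :
  <<s G >> `<=` measurable ->
  measurable_fun [set: g_sigma_algebraType G] (f : g_sigma_algebraType G -> U) ->
  measurable_fun [set: T] f.
Proof. by move=> GT mf _ B mB; apply: GT; exact: mf. Qed.

Section conditional_expectation.
Context {d : measure_display} {Omega : measurableType d} {R : realType}.
Variables (P : probability Omega R) (G : set (set Omega)).
Hypotheses (G_sigma : sigma_algebra [set: Omega] G) (G_sub : G `<=` measurable).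

Let subG : <<s G >> `<=` (measurable : set (set Omega)).
Proof. by rewrite sigma_algebra_id. Qed.

Let toG : Omega -> g_sigma_algebraType G := id.

Let mtoG : measurable_fun [set: Omega] toG.
Proof. by move=> _ B mB; rewrite setTI; exact: subG. Qed.

Let phi : {mfun Omega >-> g_sigma_algebraType G} :=
  HB.pack toG (isMeasurableFun.Build _ _ _ _ _ mtoG).

(* The restriction of P to G, as the image of P under the identity. *)
Let Q := distribution P phi.

(** Change of variables along the identity preserves the integral of the absolute value, and
    G-measurability implies measurability for the larger sigma-algebra of [Omega]. *)
Let integrable_restr (f : Omega -> \bar R) :
  measurable_fun [set: g_sigma_algebraType G] f ->
  Q.-integrable [set: g_sigma_algebraType G] f <-> P.-integrable [set: Omega] f.
Proof.
move=> mf; have mfP := measurable_fun_coarser subG mf.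
have E : (\int[Q]_x `|f x| = \int[P]_x `|f x|)%E.
  rewrite (ge0_integral_pushforward mtoG)//.
  exact: measurableT_comp.
by split=> /integrableP[_ h]; apply/integrableP; split=> //; move: h; rewrite E.
Qed.

Let integral_restr (A : set Omega) (f : Omega -> \bar R) :
  measurable_fun [set: g_sigma_algebraType G] f ->
  P.-integrable [set: Omega] f ->
  G A -> (\int[Q]_(w in A) f w = \int[P]_(w in A) f w)%E.
Proof.
move=> mf iF GA.
rewrite (integral_pushforward mtoG mf)//.
- apply: (integrableS measurableT) iF => //; exact: G_sub.
- exact: sub_sigma_algebra.
Qed.

Lemma is_condexp_ae_unique (X Y Z : Omega -> R) :
  is_condexp P G X Y -> is_condexp P G X Z -> {ae P, forall w, Y w = Z w}.
Proof.
move=> [mY iY XY] [mZ iZ XZ].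
(* The comparison is made under [Q] rather than [P]: the measurable sets of its space are exactly
   the events of [G], the only ones on which the integrals are known to agree. *)
have : ae_eq Q [set: Omega] (EFin \o Y) (EFin \o Z).
  apply: integral_ae_eq => //.
  - by apply/integrable_restr => //; exact/measurable_EFinP.
  - exact/measurable_EFinP.
  - move=> A _; rewrite measurable_g_measurableTypeE// => GA.
    rewrite !integral_restr//; try exact/measurable_EFinP.
    by rewrite XY// XZ.
(* The exceptional set [N] lies in [G], where [Q] and [P] coincide, so it is also [P]-null. *)
case=> N [mN QN YZ]; exists N; split => //; first exact: subG.
by move=> w /= YZw; apply: YZ => /= /(_ Logic.I)[].
Qed.

Lemma is_condexp_exists (X : Omega -> R) :
  P.-integrable [set: Omega] (EFin \o X) -> exists Y, is_condexp P G X Y.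
Proof.
move=> iX.
(* [induced_charge iX] lives on all events of [Omega]; its pushforward along the identity is its
   restriction to [G]. *)
have [nu nuE] : exists nu : {charge set (g_sigma_algebraType G) -> \bar R},
    nu = (fun A => \int[P]_(w in A) (X w)%:E)%E :> (set Omega -> \bar R).
  by unshelve eexists (pushforward (induced_charge iX) phi); first exact: mtoG.
have PQ : nu `<< Q.
  apply/null_content_dominatesP => A mA PA.
  rewrite nuE; apply: null_set_integral => //; first exact: subG.
  exact/measurable_funTS/(measurable_int _ iX).
have iRN := Radon_Nikodym_integrable PQ.
have mRN := measurable_int _ iRN.
(* The derivative takes extended real values but is finite at every point, so [fine] loses
   nothing. *)
have RNE : EFin \o (fine \o Radon_Nikodym nu Q) = Radon_Nikodym nu Q.
  by apply/funext => w /=; rewrite fineK// Radon_Nikodym_fin_num.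
exists (fine \o Radon_Nikodym nu Q); split.
- by apply/measurable_EFinP; rewrite RNE.
- by rewrite RNE; apply/integrable_restr.
- move=> A GA.
  transitivity (\int[P]_(w in A) Radon_Nikodym nu Q w)%E.
    by rewrite -RNE.
  rewrite -integral_restr//; last exact/integrable_restr.
  by rewrite -(Radon_Nikodym_integral PQ) ?nuE//; exact: sub_sigma_algebra.
Qed.

Lemma condexpP (X : Omega -> R) :
  P.-integrable [set: Omega] (EFin \o X) ->
  is_condexp P G X (condexp P G X).
Proof. by move=> /is_condexp_exists; exact: xgetPex. Qed.

Lemma condexp_ae_unique (X Y : Omega -> R) :
  P.-integrable [set: Omega] (EFin \o X) -> is_condexp P G X Y ->
  {ae P, forall w, condexp P G X w = Y w}.
Proof. by move=> /condexpP; exact: is_condexp_ae_unique. Qed.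

End conditional_expectation.

(** An event of [G] is also one of [H], so [Y] and [X] have the same integral on it, and testing [Z]
    against either is the same condition. *)
Lemma is_condexp_tower {d : measure_display} {Omega : measurableType d}
    {R : realType} {P : probability Omega R} {G H : set (set Omega)}
    {X Y Z : Omega -> R} :
  G `<=` H -> is_condexp P H X Y -> is_condexp P G X Z -> is_condexp P G Y Z.
Proof.
move=> GH [_ _ XY] [mZ iZ XZ]; split => // A GA.
by rewrite XZ// XY//; exact: GH.
Qed.

Lemma obs_filtration_sigma {d : measure_display} (O : measurableType d)
    (T t : nat) : sigma_algebra [set: T.+1.-tuple O] (obs_filtration O T t).
Proof. exact: smallest_sigma_algebra. Qed.

Lemma obs_filtration_le {d : measure_display} (O : measurableType d)
    (T t u : nat) : (t <= u)%N -> obs_filtration O T t `<=` obs_filtration O T u.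
Proof.
move=> tu; apply: sub_sigma_algebra2; apply: bigcup_subset => s /= st.
exact: leq_trans st tu.
Qed.

Theorem theorem1 (R : realType) (d : measure_display) (O : measurableType d)
    (T : nat) (F : set (set (T.+1.-tuple O)))
    (F_sigma : sigma_algebra [set: T.+1.-tuple O] F)
    (F_obs : obs_filtration O T T `<=` F)
    (P : probability (g_sigma_algebraType F) R)
    (S : T.+1.-tuple O -> bool)
    (S_meas : measurable_fun
       [set: g_sigma_algebraType (obs_filtration O T T)] S) :
  (forall t : nat, (t <= T)%N ->
     {ae P, forall w,
        reward P S t w = condexp P (obs_filtration O T t) (reward P S T) w})
  /\
  (forall t : nat, (t < T)%N ->
     {ae P, forall w,
        condexp P (obs_filtration O T t) (reward P S t.+1) w = reward P S t w}).
Proof.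
have sigmaF t := obs_filtration_sigma O T t.
have subF t : (t <= T)%N ->
    obs_filtration O T t `<=` (measurable : set (set (g_sigma_algebraType F))).
  by move=> tT; rewrite measurable_g_measurableTypeE//; apply: subset_trans F_obs;
    exact: obs_filtration_le.
have rT : reward P S T = label_val R S by rewrite /reward eqxx.
have mS : measurable_fun [set: g_sigma_algebraType (obs_filtration O T T)]
    (label_val R S : g_sigma_algebraType (obs_filtration O T T) -> R).
  (* Every set of booleans is measurable, in particular the set of those whose numeral lies in
     [B]. *)
  by move=> _ B _; exact: (S_meas measurableT [set b : bool | B b%:R]).
have iS : P.-integrable [set: g_sigma_algebraType F] (EFin \o label_val R S).
  (* The label lies between 0 and 1, and the constant 1 is integrable for a probability. *)
  apply: (@le_integrable _ _ _ _ _ measurableT _ (EFin \o cst 1)).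
  - apply/measurable_EFinP.
    apply: (@measurable_fun_coarser _ _ (g_sigma_algebraType F) _
      (obs_filtration O T T) _ _ mS).
    rewrite sigma_algebra_id//; exact: subF.
  - by move=> w _; rewrite /= lee_fin /label_val normr1 ger0_norm ?ler0n ?lern1 ?leq_b1.
  - exact: finite_measure_integrable_cst.
have rP t : (t <= T)%N ->
    is_condexp P (obs_filtration O T t) (label_val R S) (reward P S t).
  rewrite leq_eqVlt => /predU1P[->|tT]; first by rewrite rT; split.
  by rewrite /reward ltn_eqF//; apply: condexpP => //; exact: subF (ltnW tT).
split=> t tT.
  rewrite rT; apply: is_condexp_ae_unique (rP t tT) _ => //; first exact: subF.
  by apply: condexpP => //; exact: subF.
have tT' := ltnW tT.
(* As [t < T] unfolds to [t.+1 <= T], [rP _ tT] concerns the reward at [t.+1]; this includes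
   [t.+1 = T], where that reward is the label itself. *)
apply: condexp_ae_unique => //; [exact: subF|by have [] := rP _ tT|].
apply: is_condexp_tower (rP _ tT) (rP _ tT').
exact: obs_filtration_le.
Qed.
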